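(* For each integer $n\geq 1$, let $\tilde a_n$ be the smallest integer $k\geq 1$ such that $r_k(n)$ is prime, if the sequence $(r_k(n))_{k\geq 0}$ contains a prime, and let $\tilde a_n=-1$ otherwise. Then: (1) if $n=\mathcal{T}_2(j)$ where $j=2(\ell^2-1)$ for some integer $\ell\geq 2$, then $\tilde a_n=-1$; (2) if $n=\mathcal{T}_p(j)$ for some integer $j\geq 3$ and some odd prime $p$, then either $r_{(p-1)/2}(n)$ is not prime and $\tilde a_n=-1$, or $r_{(p-1)/2}(n)$ is the only prime in the sequence $(r_k(n))_{k\geq 0}$ and $\tilde a_n=(p-1)/2$.
   Context: For an integer $n$, the sequence $(r_k(n))_{k\in\mathbb{Z}}$ is defined by $r_0(n)=1$, $r_1(n)=n-1$ and $r_{k+2}(n)=n\,r_{k+1}(n)-r_k(n)$ for all $k\in\mathbb{Z}$. The dilated Chebyshev polynomials of the first kind $\mathcal{T}_k$ ($k\in\mathbb{Z}$) are the polynomials with $\mathcal{T}_k(2\cos\theta)=2\cos(k\theta)$; equivalently $\mathcal{T}_0(x)=2$, $\mathcal{T}_1(x)=x$, $\mathcal{T}_{k+2}(x)=x\,\mathcal{T}_{k+1}(x)-\mathcal{T}_k(x)$. In particular $\mathcal{T}_2(j)=j^2-2$. *)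

(* Defs.v *)
From mathcomp Require Import all_boot all_order all_algebra.
From mathcomp Require Import boolp.

Set Implicit Arguments.
Unset Strict Implicit.
Unset Printing Implicit Defensive.

Import Order.TTheory GRing.Theory Num.Theory.
Local Open Scope ring_scope.

Fixpoint linrec_nat (R : nzRingType) (x a b : R) (m : nat) : R :=
  if m is m'.+1 then linrec_nat x b (x * b - a) m' else a.

(* The two-sided sequence u with u 0 = a, u 1 = b and
   u (k + 2) = x * u (k + 1) - u k for all k : int (see linrecSS).
   Read from right to left, u satisfies the same recurrence, starting from
   u 0 = a and u (-1) = x * a - b; recall that Negz m is - m.+1. *)
Definition linrec (R : nzRingType) (x a b : R) (k : int) : R :=
  match k with
  | Posz m => linrec_nat x a b m
  | Negz m => linrec_nat x a (x * a - b) m.+1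
  end.

Lemma linrec_natSS (R : nzRingType) (x a b : R) (m : nat) :
  linrec_nat x a b m.+2 = x * linrec_nat x a b m.+1 - linrec_nat x a b m.
Proof. by elim: m a b => [//|m IHm] a b; apply: IHm. Qed.

Lemma linrecSS (R : nzRingType) (x a b : R) (k : int) :
  linrec x a b (k + 2) = x * linrec x a b (k + 1) - linrec x a b k.
Proof.
case: k => [m | [|[|m]]].
- have -> : Posz m + 2 = Posz m.+2 by rewrite -PoszD addn2.
  have -> : Posz m + 1 = Posz m.+1 by rewrite -PoszD addn1.
  exact: linrec_natSS.
- by rewrite /= subKr.
- by rewrite /= subKr.
- have -> : Negz m.+2 + 2 = Negz m by rewrite !NegzE -[m.+3]addn2 PoszD opprD subrK.
  have -> : Negz m.+2 + 1 = Negz m.+1 by rewrite !NegzE -[m.+3]addn1 PoszD opprD subrK.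
  by rewrite /linrec (linrec_natSS _ _ _ m.+1) subKr.
Qed.

Definition r (k n : int) : int := linrec n 1 (n - 1) k.

(* Dilated Chebyshev polynomials of the first kind:
   T_k (2 cos t) = 2 cos (k t). *)
Definition chebT (k : int) : {poly int} := linrec 'X 2%:R%:P 'X k.

Lemma r0 (n : int) : r 0 n = 1. Proof. by []. Qed.

Lemma r1 (n : int) : r 1 n = n - 1. Proof. by []. Qed.

Lemma rSS (k n : int) : r (k + 2) n = n * r (k + 1) n - r k n.
Proof. exact: linrecSS. Qed.

Lemma chebT0 : chebT 0 = 2%:R%:P. Proof. by []. Qed.

Lemma chebT1 : chebT 1 = 'X. Proof. by []. Qed.

Lemma chebTSS (k : int) : chebT (k + 2) = 'X * chebT (k + 1) - chebT k.
Proof. exact: linrecSS. Qed.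

Lemma horner_chebT2 (j : int) : (chebT 2).[j] = j ^+ 2 - 2.
Proof. by rewrite /chebT /= !hornerE -expr2. Qed.

Definition prime_int (z : int) : bool := (0 <= z) && prime `|z|%N.

Lemma ex_prime_index (n : int) :
  (exists k : nat, prime_int (r k n)) ->
  exists k : nat, (1 <= k)%N && prime_int (r k n).
Proof. by case=> [[|k] //] rk_prime; exists k.+1. Qed.

Definition atilde (n : int) : int :=
  match pselect (exists k : nat, prime_int (r k n)) with
  | left r_prime => Posz (ex_minn (ex_prime_index r_prime))
  | right _ => -1
  end.

(* Main.v *)
(* Put z + 1/z = x and [m] = z^(m/2) + z^(-m/2).  Then r_k(x) = [2k+1] / [1] and
   T_p(x) = [2p], whence, for p = 2h + 1, q = 2k + 1 and n = T_p(j),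
     r_k(n) * r_h(j) = r_(h + kp)(j) = r_h(T_q(j)) * r_k(j).
   If r_k(n) is prime and k > 0, it is larger than r_k(j) and so divides
   r_h(T_q(j)); hence r_k(j) divides r_h(j), which forces q to divide p.
   In case (1), j * r_k(j^2 - 2) = [4k+2] = (j + 2) * r_k(j)^2 - 2 becomes
     (l^2 - 1) * r_k(n) = (l * r_k(j) - 1) * (l * r_k(j) + 1),
   and each factor on the right is too small to be divisible by r_k(n). *)
Require Import Defs.
From mathcomp Require Import all_boot all_order all_algebra.
From mathcomp Require Import boolp zify ring.

Set Implicit Arguments.
Unset Strict Implicit.
Unset Printing Implicit Defensive.

Import Order.TTheory GRing.Theory Num.Theory.
Local Open Scope ring_scope.

Lemma prime_int_dvdzM (p a b : int) :
  prime_int p -> (p %| a * b)%Z -> (p %| a)%Z || (p %| b)%Z.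
Proof. by case/andP=> _ p_pr; rewrite !dvdzE abszM Euclid_dvdM. Qed.

Lemma dvdz_le (d m : int) : 0 < m -> (d %| m)%Z -> d <= m.
Proof.
move=> m_gt0; rewrite dvdzE => /dvdn_leq; rewrite absz_gt0 gt_eqF // => /(_ isT).
by lia.
Qed.

Lemma r_natSS (k : nat) (x : int) : r k.+2 x = x * r k.+1 x - r k x.
Proof. exact: linrec_natSS. Qed.

Lemma horner_chebT_natSS (p : nat) (x : int) :
  (chebT p.+2).[x] = x * (chebT p.+1).[x] - (chebT p).[x].
Proof.
have -> : chebT p.+2 = 'X * chebT p.+1 - chebT p by exact: linrec_natSS.
by rewrite !hornerE.
Qed.

(** [m] is even in m, and the index -m - 1 yields [-2m - 1]. *)
Lemma r_oppS (m : nat) (x : int) : r (- (m%:Z + 1)) x = r m x.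
Proof.
have -> : - (m%:Z + 1) = Negz m by rewrite NegzE -addn1 PoszD.
by rewrite /r /linrec /= mulr1 subKr mulr1.
Qed.

(** This is [2k+1 + 2p] + [2k+1 - 2p] = [2p] * [2k+1], divided by [1]. *)
Lemma r_shift (k : int) (p : nat) (x : int) :
  r (k + p%:Z) x + r (k - p%:Z) x = (chebT p).[x] * r k x.
Proof.
suff [] : r (k + p%:Z) x + r (k - p%:Z) x = (chebT p).[x] * r k x /\
  r (k + p.+1%:Z) x + r (k - p.+1%:Z) x = (chebT p.+1).[x] * r k x by [].
elim: p => [|p [IH0 IH1]].
  rewrite /chebT /= !hornerE; split; first by ring.
  have := rSS (k - 1) x.
  have -> : k - 1 + 2 = k + 1 by ring.
  by rewrite subrK => ->; ring.
split=> //; rewrite horner_chebT_natSS mulrBl -mulrA -IH0 -IH1.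
have := rSS (k + p%:Z) x; have := rSS (k - p.+2%:Z) x.
have -> : k - p.+2%:Z + 2 = k - p%:Z by lia.
have -> : k - p.+2%:Z + 1 = k - p.+1%:Z by lia.
have -> : k + p%:Z + 2 = k + p.+2%:Z by lia.
have -> : k + p%:Z + 1 = k + p.+1%:Z by lia.
by move=> E ->; rewrite E; ring.
Qed.

(** By [r_shift], the terms of index h + k * p satisfy, as a sequence in k, the recurrence with
    coefficient T_p(x) that defines the left factor; two initial values then suffice. *)
Lemma r_chebT_mul (h k : nat) (x : int) :
  r k (chebT h.*2.+1).[x] * r h x = r (h + k * h.*2.+1)%N x.
Proof.
set p := h.*2.+1; set y := (chebT p).[x].
suff [] : r k y * r h x = r (h + k * p)%N x /\
  r k.+1 y * r h x = r (h + k.+1 * p)%N x by [].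
elim: k => [|k [IH0 IH1]].
  rewrite mul0n mul1n addn0 r0 mul1r; split=> //.
  have := r_shift h p x.
  (* Since p = 2h + 1, this negative index is the mirror image of h under [r_oppS]. *)
  have -> : h%:Z - p%:Z = - (h%:Z + 1) by rewrite /p; lia.
  by rewrite r_oppS PoszD r1 => E; rewrite mulrBl mul1r -E addrK.
split=> //; rewrite r_natSS mulrBl -mulrA IH0 IH1.
have := r_shift (h + k.+1 * p)%N p x.
have -> : (h + k.+1 * p)%N%:Z + p%:Z = (h + k.+2 * p)%N by lia.
have -> : (h + k.+1 * p)%N%:Z - p%:Z = (h + k * p)%N by lia.
by move=> <-; rewrite addrK.
Qed.

(** The index h + k(2h + 1) is symmetric in h and k. *)
Lemma r_chebT_exchange (h k : nat) (x : int) :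
  r k (chebT h.*2.+1).[x] * r h x = r h (chebT k.*2.+1).[x] * r k x.
Proof. by rewrite !r_chebT_mul; congr (r (Posz _) _); lia. Qed.

Lemma r_gt0_ltS (k : nat) (x : int) : 3 <= x -> 0 < r k x < r k.+1 x.
Proof.
move=> x_ge3; elim: k => [|k IHk]; first by rewrite r0 r1; lia.
by rewrite r_natSS; nia.
Qed.

Lemma r_gt0 (k : nat) (x : int) : 3 <= x -> 0 < r k x.
Proof. by move=> /(r_gt0_ltS k)/andP[]. Qed.

Lemma r_ltn (i k : nat) (x : int) : 3 <= x -> (i < k)%N -> r i x < r k x.
Proof.
move=> x_ge3; elim: k => [//|k IHk]; rewrite ltnS leq_eqVlt.
have /andP[_ rk_lt] := r_gt0_ltS k x_ge3.
by case/predU1P=> [-> //|/IHk /lt_trans]; apply.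
Qed.

Lemma ltr_r (k : nat) (x y : int) :
  3 <= x -> x < y -> (0 < k)%N -> r k x < r k y.
Proof.
move=> x_ge3 lt_xy; case: k => // k _.
(* Positivity of the gap alone is not inductive; its growth with the index is carried along,
   starting from gap 0 at index 0. *)
suff : 0 <= r k y - r k x < r k.+1 y - r k.+1 x by lia.
elim: k => [|k IHk]; first by rewrite !r0 !r1; lia.
have y_gt0 : 0 < r k.+1 y by apply: r_gt0; lia.
by rewrite !r_natSS; nia.
Qed.

Lemma chebT_gt (p : nat) (x : int) :
  3 <= x -> (1 < p)%N -> x < (chebT p).[x].
Proof.
move=> x_ge3; case: p => [//|[//|p _]].
suff : x <= (chebT p.+1).[x] < (chebT p.+2).[x] by lia.
elim: p => [|p IHp]; first by rewrite /chebT /= !hornerE; nia.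
by rewrite (horner_chebT_natSS p.+1); nia.
Qed.

(* Modulo r_k one has r_(k+t) = - r_(k-t), so i may be reduced modulo 2k+1. *)
Lemma r_dvd_index (i k : nat) (x : int) :
  3 <= x -> (r k x %| r i x)%Z -> (k.*2.+1 %| i.*2.+1)%N.
Proof.
move=> x_ge3; have rk_gt0 := r_gt0 k x_ge3.
have reflect_dvd (t : nat) :
    (r k x %| r (k%:Z + t%:Z) x)%Z -> (r k x %| r (k%:Z - t%:Z) x)%Z.
  move=> dvd_t; have /(canRL (addKr _)) -> := r_shift k t x.
  by rewrite rpredD ?rpredN ?dvd_t ?dvdz_mull.
have small (m : nat) : (m < k)%N -> (r k x %| r m x)%Z -> False.
  by move=> lt_mk /(dvdz_le (r_gt0 m x_ge3)); rewrite leNgt r_ltn.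
elim/ltn_ind: i => i IHi dvd_i.
have [lt_ik|lt_ki|-> //] := ltngtP i k; first by case: (small i).
have := reflect_dvd (i - k)%N.
have -> : k%:Z + (i - k)%N%:Z = i by lia.
move=> /(_ dvd_i) {}dvd_i.
(* The reflected index is 2k - i. If it is nonnegative, it lies below k, against [small]; if
   negative, [r_oppS] turns it into i - (2k + 1). *)
have [le_i2k|lt_2ki] := leqP i k.*2.
  case: (small (k.*2 - i)%N); first by lia.
  by have <- : k%:Z - (i - k)%N%:Z = (k.*2 - i)%N by lia.
have dvd_i' : (r k x %| r (i - k.*2.+1)%N x)%Z.
  rewrite -r_oppS.
  by have <- : k%:Z - (i - k)%N%:Z = - ((i - k.*2.+1)%N%:Z + 1) by lia.
have := IHi _ _ dvd_i'; rewrite ltn_subrL /= (leq_trans _ lt_ki) // => /(_ isT).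
have -> : i.*2.+1 = ((i - k.*2.+1).*2.+1 + 2 * k.*2.+1)%N by lia.
by move=> dvd'; rewrite dvdn_addl ?dvdn_mull.
Qed.

Lemma prime_r_chebT_index (j : int) (h k : nat) :
  3 <= j -> prime h.*2.+1 -> prime_int (r k (chebT h.*2.+1).[j]) -> k = h.
Proof.
move=> j_ge3 p_pr; case: k => [//|k] P_pr.
have lt_jn : j < (chebT h.*2.+1).[j] by rewrite chebT_gt ?prime_gt1.
have rk_gt0 := r_gt0 k.+1 j_ge3; have E := r_chebT_exchange h k.+1 j.
have : (r k.+1 (chebT h.*2.+1).[j] %| r h (chebT k.+1.*2.+1).[j] * r k.+1 j)%Z.
  by rewrite -E dvdz_mulr.
case/(prime_int_dvdzM P_pr)/orP => [/dvdzP[c Ec]|/(dvdz_le rk_gt0)]; last first.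
  by rewrite leNgt ltr_r.
have P_gt0 : 0 < r k.+1 (chebT h.*2.+1).[j] by apply: r_gt0; lia.
(* The prime is cancelled from the exchange identity [E]. *)
have Erh : r h j = c * r k.+1 j.
  by apply: (mulfI (lt0r_neq0 P_gt0)); rewrite E Ec; ring.
have /(r_dvd_index j_ge3) : (r k.+1 j %| r h j)%Z by rewrite Erh dvdz_mull.
by case/primeP: p_pr => _ dv /dv; lia.
Qed.

(** The form a^2 + b^2 - xab is invariant under the recurrence step (a, b) -> (b, xb - a). *)
Lemma r_norm (k : nat) (x : int) :
  r k x ^+ 2 + r k.+1 x ^+ 2 - x * r k x * r k.+1 x = 2 - x.
Proof.
elim: k => [|k <-]; first by rewrite r0 r1; ring.
by rewrite r_natSS; ring.
Qed.

Lemma r_sqrB2 (k : nat) (x : int) :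
  x * r k (x ^+ 2 - 2) = (x + 2) * r k x ^+ 2 - 2.
Proof.
suff [] : x * r k (x ^+ 2 - 2) = (x + 2) * r k x ^+ 2 - 2 /\
  x * r k.+1 (x ^+ 2 - 2) = (x + 2) * r k.+1 x ^+ 2 - 2 by [].
elim: k => [|k [IH0 IH1]]; first by rewrite !r0 !r1; split; ring.
split=> //; rewrite !r_natSS mulrBr mulrCA IH0 IH1.
have := r_norm k x; move: (r k x) (r k.+1 x) => a b N.
apply/eqP; rewrite -subr_eq0; apply/eqP.
(* The two sides differ by a multiple of the defect in the invariant [r_norm], which vanishes. *)
transitivity (2 * (x + 2) * (2 - x - (a ^+ 2 + b ^+ 2 - x * a * b))); first by ring.
by rewrite N subrr mulr0.
Qed.

Lemma r_sqrB2_not_prime (l : int) (k : nat) :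
  2 <= l -> ~ prime_int (r k ((2 * (l ^+ 2 - 1)) ^+ 2 - 2)).
Proof.
move=> l_ge2; set j := 2 * (l ^+ 2 - 1); case: k => [//|k] P_pr.
have j_ge3 : 3 <= j by rewrite /j; nia.
(* The bound is the value r_1(j), the least one at a positive index. *)
have rk_ge : j - 1 <= r k.+1 j.
  by case: k {P_pr} => [|k]; rewrite -?r1 // ltW // r_ltn.
have := r_sqrB2 k.+1 j.
move: (r k.+1 (j ^+ 2 - 2)) (r k.+1 j) P_pr rk_ge => P b P_pr; rewrite {}/j in j_ge3 * => rk_ge E.
(* The choice of j makes j + 2 = 2l^2, so half the right side is the difference of squares (lb)^2 -
   1. *)
have {}E : (l ^+ 2 - 1) * P = (l * b - 1) * (l * b + 1) by lia.
have lt_lb : l < b by nia.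
have : (P %| (l * b - 1) * (l * b + 1))%Z by rewrite -E dvdz_mull.
(* By [E] this amounts to l^2 - 1 < lb - 1, which follows from l < b. *)
have lt_P : l * b + 1 < P.
  have lb_gt0 : 0 < l * b + 1 by nia.
  have l2_gt0 : 0 < l ^+ 2 - 1 by nia.
  by rewrite -(ltr_pM2l l2_gt0) E ltr_pM2r // ltrD2r; nia.
case/(prime_int_dvdzM P_pr)/orP => dvd_P.
  have /dvdz_le/(_ dvd_P) : 0 < l * b - 1 by nia.
  by lia.
have /dvdz_le/(_ dvd_P) : 0 < l * b + 1 by nia.
by lia.
Qed.

Lemma atilde_none (n : int) :
  (forall k : nat, ~ prime_int (r k n)) -> atilde n = -1.
Proof.
rewrite /atilde => none; case: pselect => // r_prime.
by case: {-}r_prime => k rk_pr; case: (none k).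
Qed.

Lemma atilde_unique (n : int) (h : nat) : prime_int (r h n) ->
  (forall k : nat, prime_int (r k n) -> k = h) -> atilde n = h.
Proof.
rewrite /atilde => h_pr uniq_h; case: pselect => [ex|[]]; last by exists h.
by case: ex_minnP => m /andP[_ /uniq_h ->].
Qed.

Theorem theorem46 (n : int) (n_ge1 : 1 <= n) :
  (forall l j : int, 2 <= l -> j = 2 * (l ^+ 2 - 1) ->
     n = (chebT 2).[j] -> atilde n = -1)
  /\
  (forall (j : int) (p : nat), 3 <= j -> prime p -> odd p ->
     n = (chebT p).[j] ->
     (~ prime_int (r ((p - 1) %/ 2)%N n) /\ atilde n = -1)
     \/
     [/\ prime_int (r ((p - 1) %/ 2)%N n),
         forall k : nat, prime_int (r k n) -> k = ((p - 1) %/ 2)%N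
       & atilde n = ((p - 1) %/ 2)%N]).
Proof.
split=> [l j l_ge2 -> En|j p j_ge3 p_pr p_odd En].
  by apply: atilde_none => k; rewrite En horner_chebT2; apply: r_sqrB2_not_prime.
set h := ((p - 1) %/ 2)%N.
have Ep : p = h.*2.+1 by rewrite /h; lia.
have uniq_h (k : nat) : prime_int (r k n) -> k = h.
  by move: p_pr; rewrite En Ep; apply: prime_r_chebT_index.
have [h_pr|h_npr] := boolP (prime_int (r h n)); [right|left]; split=> //.
- exact: atilde_unique.
- apply: atilde_none => k k_pr; move: h_npr.
  by rewrite -(uniq_h k k_pr) k_pr.
Qed.
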